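(* Let $G=([n],E)$ be a tensegrity graph with $E=B\cup C\cup S$ and consider a tensegrity framework $G(\mathbf{p})$ in $\mathbb{R}^d$ such that $p_1,\ldots,p_n$ span $\mathbb{R}^d$ linearly. Assume there exists a matrix $Z\in\mathcal{S}^n$ satisfying the following conditions (i)-(vi): (i) $Z$ is positive semidefinite. (ii) $Z_{ij}=0$ for all $\{i,j\}\in\overline{E}$. (iii) $Z_{ij}\ge 0$ for all (cables) $\{i,j\}\in C$ and $Z_{ij}\le 0$ for all (struts) $\{i,j\}\in S$. (iv) $Z$ has corank $d$. (v) $\sum_{j\in V}Z_{ij}p_j=0$ for all $i\in[n]$, where $V=[n]$. (vi) For any matrix $R\in\mathcal{S}^d$ the following holds: if $p_i^{T}R\,p_j=0$ for all $\{i,j\}\in V\cup B\cup\{\{i,j\}\in C\cup S: Z_{ij}\neq 0\}$, then $R=0$. Then the tensegrity framework $G(\mathbf{p})$ is universally completable.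
   Context: $[n]=\{1,\ldots,n\}$; $\mathcal{S}^n$ is the set of real symmetric $n\times n$ matrices; the corank of a matrix is the dimension of its kernel; $X\succeq 0$ means $X$ is positive semidefinite. The node set $V=[n]$ is identified with the set of diagonal pairs $\{i,i\}$, $i\in V$. For a graph $G=(V,E)$, $\overline{E}$ denotes the set of pairs $\{i,j\}$ with $i\neq j$ and $\{i,j\}\notin E$. A tensegrity graph is a graph $G$ whose edge set is partitioned into three sets $E=B\cup C\cup S$, whose members are called bars, cables and struts, respectively. A tensegrity framework $G(\mathbf{p})$ in $\mathbb{R}^d$ consists of a tensegrity graph $G$ on nodes $[n]$ together with an assignment of vectors $\mathbf{p}=\{p_1,\ldots,p_n\}\subseteq\mathbb{R}^d$ to its nodes. The Gram matrix of $p_1,\ldots,p_n$ is $\mathrm{Gram}(p_1,\ldots,p_n)=(p_i^{T}p_j)_{i,j=1}^n$. The framework $G(\mathbf{p})$ is called universally completable if $\mathrm{Gram}(p_1,\ldots,p_n)$ is the unique matrix $X\in\mathcal{S}^n$ satisfying: $X\succeq 0$; $X_{ij}=p_i^{T}p_j$ for all $\{i,j\}\in V\cup B$; $X_{ij}\le p_i^{T}p_j$ for all $\{i,j\}\in C$; $X_{ij}\ge p_i^{T}p_j$ for all $\{i,j\}\in S$. *)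

(* Defs.v *)
From HB Require Import structures.
From mathcomp Require Import all_boot all_order all_algebra.
From mathcomp Require Import reals.

Set Implicit Arguments.
Unset Strict Implicit.
Unset Printing Implicit Defensive.

Import Order.TTheory GRing.Theory Num.Theory.
Local Open Scope ring_scope.

Record simple_graph (n : nat) := SimpleGraph {
  edges : {set {set 'I_n}};
  card_edge : forall e, e \in edges -> #|e| = 2%N
}.

(* Any of the three classes may be empty. *)
Record tensegrity_graph (n : nat) := TensegrityGraph {
  underlying_graph :> simple_graph n;
  bars : {set {set 'I_n}};
  cables : {set {set 'I_n}};
  struts : {set {set 'I_n}};
  edges_union : edges underlying_graph = bars :|: cables :|: struts;
  bars_cables_disjoint : [disjoint bars & cables];
  bars_struts_disjoint : [disjoint bars & struts];
  cables_struts_disjoint : [disjoint cables & struts]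
}.

(* The node i is identified with the diagonal pair {i, i}; as a set,
   [set i; i] is the singleton [set i]. *)
Definition node_pairs (n : nat) : {set {set 'I_n}} :=
  [set [set i; i] | i : 'I_n].

Definition nonedges (n : nat) (G : simple_graph n) : {set {set 'I_n}} :=
  [set e : {set 'I_n} | (#|e| == 2%N) && (e \notin edges G)].

Definition psdmx (R : realType) (n : nat) (A : 'M[R]_n) : Prop :=
  A \is symmetricmx /\ forall x : 'cV[R]_n, 0 <= (x^T *m A *m x) 0 0.

(* The column space of cokermx A is the kernel {v | A *m v = 0}, whereas
   kermx A describes the row kernel {u | u *m A = 0}. *)
Definition corank (R : realType) (n : nat) (A : 'M[R]_n) : nat :=
  \rank (cokermx A).

Definition dotv (R : realType) (d : nat) (x y : 'cV[R]_d) : R :=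
  (x^T *m y) 0 0.

Definition gram (R : realType) (n d : nat) (p : 'I_n -> 'cV[R]_d) : 'M[R]_n :=
  \matrix_(i, j) dotv (p i) (p j).

Definition psd_completion (R : realType) (n d : nat) (G : tensegrity_graph n)
    (p : 'I_n -> 'cV[R]_d) (X : 'M[R]_n) : Prop :=
  [/\ X \is symmetricmx,
      psdmx X,
      forall i j, [set i; j] \in node_pairs n :|: bars G ->
        X i j = dotv (p i) (p j),
      forall i j, [set i; j] \in cables G -> X i j <= dotv (p i) (p j)
    & forall i j, [set i; j] \in struts G -> X i j >= dotv (p i) (p j)].

Definition universally_completable (R : realType) (n d : nat)
    (G : tensegrity_graph n) (p : 'I_n -> 'cV[R]_d) : Prop :=
  unique (psd_completion G p) (gram p).

(* Main.v *)
Require Import Defs.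
From HB Require Import structures.
From mathcomp Require Import all_boot all_order all_algebra.
From mathcomp Require Import reals ring lra.

Set Implicit Arguments.
Unset Strict Implicit.
Unset Printing Implicit Defensive.

Import Order.TTheory GRing.Theory Num.Theory.
Local Open Scope ring_scope.

(** Let Q be the d x n matrix with columns p_i, so Q has rank d, the row kernel
    of Z is the row space of Q, and the Gram matrix is Q^T Q.  For a feasible X
    every term Z_ij (X_ij - p_i^T p_j) is nonpositive, hence tr (Z X) <= 0.
    Writing the positive semidefinite X as a sum of outer products v v^T gives
    tr (Z X) = sum v^T Z v, so each v lies in the kernel of Z and X = Q^T W Q
    for a symmetric W.  Then tr (Z X) = 0, every term vanishes, and W - 1
    satisfies the hypothesis of (vi), so W = 1. *)

(** * Positive semidefinite forms: Cauchy-Schwarz and decomposition into outer products *)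

Lemma symmetricmxP (R : realType) n (A : 'M[R]_n) :
  reflect (A^T = A) (A \is symmetricmx).
Proof.
by apply: (iffP (is_hermitianmxP _ _ _)); rewrite expr0 scale1r map_mx_id.
Qed.

Definition bform (R : realType) n (A : 'M[R]_n) (x y : 'cV[R]_n) : R :=
  (x^T *m A *m y) 0 0.

Lemma bformC (R : realType) n (A : 'M[R]_n) x y :
  A \is symmetricmx -> bform A x y = bform A y x.
Proof.
move/symmetricmxP=> sA; rewrite /bform.
by rewrite -[x^T *m A *m y]trmxK [LHS]mxE !trmx_mul trmxK sA mulmxA.
Qed.

Lemma bform_line (R : realType) n (A : 'M[R]_n) x y t :
    A \is symmetricmx ->
  bform A (y + t *: x) (y + t *: x) =
    bform A y y + 2 * t * bform A x y + t ^+ 2 * bform A x x.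
Proof.
move=> sA; have := bformC y x sA; rewrite /bform => byx.
have -> : (y + t *: x)^T = y^T + t *: x^T by rewrite linearD linearZ.
rewrite !mulmxDl !mulmxDr -!scalemxAl -!scalemxAr scalerA.
have DE (M N : 'M[R]_1) : (M + N) 0 0 = M 0 0 + N 0 0 by rewrite mxE.
have ZE a (M : 'M[R]_1) : (a *: M) 0 0 = a * M 0 0 by rewrite mxE.
by rewrite !DE !ZE byx; ring.
Qed.

(** The form is nonnegative along the line [y + t *: x], so a quadratic polynomial in [t] is
    nonnegative everywhere. When its leading coefficient vanishes it is affine, which forces the
    linear coefficient to vanish too. *)
Lemma psdmx_CauchySchwarz (R : realType) n (A : 'M[R]_n) x y :
  psdmx A -> bform A x y ^+ 2 <= bform A x x * bform A y y.
Proof.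
case=> sA Age0.
have q_ge0 t : 0 <= bform A y y + 2 * t * bform A x y + t ^+ 2 * bform A x x.
  by rewrite -bform_line //; apply: Age0.
have [bxx0|bxxN0] := eqVneq (bform A x x) 0.
  have [-> | bxyN0] := eqVneq (bform A x y) 0; first by rewrite bxx0 mul0r expr0n.
  (* At this [t] the affine function would take the value -1. *)
  have := q_ge0 (- (bform A y y + 1) / (2 * bform A x y)).
  rewrite bxx0 mulr0 addr0.
  suff -> : bform A y y + 2 * (- (bform A y y + 1) / (2 * bform A x y)) *
    bform A x y = -1 by lra.
  by field.
have bxx_gt0 : 0 < bform A x x by rewrite lt_def bxxN0; apply: Age0.
(* This [t] minimises the quadratic; multiplying its value there by [bform A x x] gives the
   difference of the two sides. *)
have := q_ge0 (- bform A x y / bform A x x).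
rewrite -(pmulr_rge0 _ bxx_gt0).
set e := (X in 0 <= X).
suff -> : e = bform A x x * bform A y y - bform A x y ^+ 2 by rewrite subr_ge0.
by rewrite /e; field.
Qed.

Lemma bform_delta (R : realType) n (A : 'M[R]_n) x i :
  bform A x (delta_mx i 0) = (x^T *m A) 0 i.
Proof. by rewrite /bform -colE mxE. Qed.

Lemma bform_delta2 (R : realType) n (A : 'M[R]_n) i j :
  bform A (delta_mx i 0) (delta_mx j 0) = A i j.
Proof. by rewrite bform_delta trmx_delta -rowE mxE. Qed.

(** Cauchy-Schwarz against each basis vector bounds the square of every entry of [x^T *m A] by 0. *)
Lemma psdmx_isotropic (R : realType) n (A : 'M[R]_n) x :
  psdmx A -> bform A x x = 0 -> x^T *m A = 0.
Proof.
move=> psdA bxx0; apply/rowP=> i; rewrite -bform_delta mxE.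
apply/eqP; rewrite -sqrf_eq0 eq_le sqr_ge0 andbT.
by have := psdmx_CauchySchwarz x (delta_mx i 0) psdA; rewrite bxx0 mul0r.
Qed.

Lemma psdmx_diag0 (R : realType) n (A : 'M[R]_n) :
  psdmx A -> (forall i, A i i = 0) -> A = 0.
Proof.
move=> psdA diag0; apply/row_matrixP=> i; rewrite rowE -trmx_delta row0.
by apply: psdmx_isotropic => //; rewrite bform_delta2.
Qed.

(* The Schur complement of a positive diagonal entry, before deleting its row
   and column, is positive semidefinite by Cauchy-Schwarz. *)
Lemma psdmx_pivot (R : realType) n (A : 'M[R]_n) i (c : R) :
  psdmx A -> 0 < c -> c ^+ 2 = A i i ->
  psdmx (A - (c^-1 *: col i A) *m (c^-1 *: col i A)^T).
Proof.
move=> psdA c_gt0 c2; have [sA _] := psdA; split.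
  apply/symmetricmxP; rewrite linearB /= trmx_mul trmxK.
  by rewrite (symmetricmxP _ sA).
move=> x; set v := c^-1 *: col i A.
have xv : (x^T *m v) 0 0 = c^-1 * bform A x (delta_mx i 0).
  by rewrite /v -scalemxAr mxE colE mulmxA.
have xvvx : (x^T *m (v *m v^T) *m x) 0 0 = (x^T *m v) 0 0 ^+ 2.
  rewrite mulmxA -[_ *m v^T *m x]mulmxA -[v^T *m x]trmxK trmx_mul trmxK.
  by rewrite mxE big_ord1 [_^T _ _]mxE -expr2.
have BE (M N : 'M[R]_1) : (M - N) 0 0 = M 0 0 - N 0 0 by rewrite !mxE.
rewrite mulmxBr mulmxBl BE xvvx xv subr_ge0.
rewrite exprMn exprVn mulrC ler_pdivrMr ?exprn_gt0 //.
by have := psdmx_CauchySchwarz x (delta_mx i 0) psdA; rewrite bform_delta2 c2.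
Qed.

(** Induction on the number of nonzero diagonal entries: subtracting the outer product of a scaled
    column clears one of them and creates no new one. Once the diagonal is zero, every basis vector
    is isotropic and the matrix is zero. *)
Lemma psdmx_sum_outer (R : realType) n (A : 'M[R]_n) :
  psdmx A -> exists s : seq 'cV[R]_n, A = \sum_(v <- s) v *m v^T.
Proof.
have [k] := ubnP #|[set i | A i i != 0]|.
elim: k A => // k IHk A; rewrite ltnS => leAk psdA.
have [i AiiN0|diag0] := pickP (fun i => A i i != 0); last first.
  exists [::]; rewrite big_nil; apply: psdmx_diag0 => // i.
  by apply/eqP; move/negbFE: (diag0 i).
have diag_ge0 (B : 'M[R]_n) : psdmx B -> forall j, 0 <= B j j.
  by case=> _ Bge0 j; rewrite -bform_delta2; apply: Bge0.
have Aii_gt0 : 0 < A i i by rewrite lt_def AiiN0 diag_ge0.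
pose c := Num.sqrt (A i i).
have c_gt0 : 0 < c by rewrite sqrtr_gt0.
have c2 : c ^+ 2 = A i i by rewrite sqr_sqrtr // ltW.
pose v := c^-1 *: col i A.
have psdB := psdmx_pivot psdA c_gt0 c2; rewrite -/v in psdB.
have BE j : (A - v *m v^T) j j = A j j - v j 0 ^+ 2.
  by rewrite 2!mxE; congr (_ - _); rewrite mxE big_ord1 [_^T _ _]mxE.
have [|s eqs] := IHk _ _ psdB.
  (* A zero diagonal entry stays zero, since the new one is both nonnegative and the opposite of a
     square. The pivot entry becomes [c ^+ 2 - c ^+ 2]. *)
  apply: leq_trans leAk; apply: proper_card; apply/properP; split.
    apply/subsetP=> j; rewrite !in_set; apply: contraNneq => Ajj0.
    rewrite eq_le diag_ge0 // andbT BE Ajj0 sub0r oppr_le0; exact: sqr_ge0.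
  exists i; rewrite !in_set ?negbK // BE.
  have -> : v i 0 = c by rewrite !mxE -c2 expr2 mulKf ?gt_eqF.
  by rewrite c2 subrr.
by exists (v :: s); rewrite big_cons -eqs addrC subrK.
Qed.

(** * The trace pairing of two matrices *)

Lemma mxtrace_mul_outer (R : realType) n (Z : 'M[R]_n) (s : seq 'cV[R]_n) :
  \tr (Z *m \sum_(v <- s) v *m v^T) = \sum_(v <- s) bform Z v v.
Proof.
rewrite mulmx_sumr raddf_sum; apply: eq_bigr => v _ /=.
by rewrite mulmxA mxtrace_mulC mulmxA trace_mx11.
Qed.

Lemma mxtrace_mul_sym (R : realType) n (Z X : 'M[R]_n) :
  X \is symmetricmx -> \tr (Z *m X) = \sum_i \sum_j Z i j * X i j.
Proof.
move=> /symmetricmxP sX; apply: eq_bigr => i _; rewrite mxE.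
by apply: eq_bigr => j _; rewrite -{1}sX mxE.
Qed.

Lemma psdmx_factor_of_trace_le0 (R : realType) n d (Z X : 'M[R]_n)
    (Q : 'M[R]_(d, n)) :
    psdmx Z -> psdmx X -> \tr (Z *m X) <= 0 -> (kermx Z <= Q)%MS ->
  exists2 W : 'M[R]_d, W \is symmetricmx & X = Q^T *m W *m Q.
Proof.
move=> psdZ /psdmx_sum_outer[s ->]; rewrite mxtrace_mul_outer => tr_le0 kerQ.
have [_ Zge0] := psdZ.
have : \sum_(v <- s) bform Z v v == 0.
  by rewrite eq_le tr_le0 sumr_ge0 // => v _; apply: Zge0.
rewrite psumr_eq0 => [/allP s0|v _]; last exact: Zge0.
(* The row [v^T *m pinvmx Q] holds coordinates of [v^T] on the rows of [Q]; they exist because [v^T]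
   lies in the row kernel of [Z]. *)
exists (\sum_(v <- s) (v^T *m pinvmx Q)^T *m (v^T *m pinvmx Q)).
  apply/symmetricmxP; rewrite raddf_sum; apply: eq_bigr => v _ /=.
  by rewrite trmx_mul trmxK.
rewrite mulmx_sumr mulmx_suml; apply: eq_big_seq => v /s0/eqP bvv0.
have vQ : v^T *m pinvmx Q *m Q = v^T.
  apply: mulmxKpV; apply: submx_trans kerQ; apply/sub_kermxP.
  exact: psdmx_isotropic.
by rewrite mulmxA -trmx_mul vQ trmxK -mulmxA vQ.
Qed.

(** * Tensegrity frameworks and their Gram matrices *)

Lemma row_free_span (R : realType) n d (p : 'I_n -> 'cV[R]_d) :
  span [seq p i | i : 'I_n] = fullv ->
  row_free (\matrix_(k < d, j < n) p j k 0).
Proof.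
move=> p_span; rewrite -kermx_eq0; apply/eqP/row_matrixP=> i; rewrite row0.
set Q := \matrix_(_, _) _; set u := row i _.
have uQ : u *m Q = 0 by rewrite -row_mul mulmx_ker row0.
suff u0 w : u *m w = 0 :> 'M_1.
  by apply/rowP=> k; have /matrixP/(_ 0 0) := u0 (delta_mx k 0); rewrite -colE !mxE.
(* As [u] annihilates every column [p j] of [Q], it annihilates their span, which contains every
   [w]. *)
have /coord_span -> : w \in <<in_tuple [seq p i | i : 'I_n]>>%VS.
  by rewrite p_span memvf.
rewrite mulmx_sumr big1 // => k _; rewrite -scalemxAr.
have /mapP[j _ ->] := mem_nth 0 (ltn_ord k : (k < size _)%N).
suff -> : p j = col j Q by rewrite colE mulmxA uQ mul0mx scaler0.
by apply/colP=> l; rewrite !mxE.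
Qed.

Lemma tensegrity_pair_cases n (G : tensegrity_graph n) (i j : 'I_n) :
  [\/ [set i; j] \in node_pairs n :|: bars G, [set i; j] \in cables G,
      [set i; j] \in struts G | [set i; j] \in nonedges G].
Proof.
have [->|neq_ij] := eqVneq i j.
  by constructor 1; rewrite in_setU; apply/orP; left; apply/imsetP; exists j.
have [|ijE] := boolP ([set i; j] \in edges G); last first.
  by constructor 4; rewrite in_set cards2 neq_ij.
rewrite edges_union !in_setU => /orP[/orP[ijB|ijC]|ijS].
- by constructor 1; rewrite ijB orbT.
- by constructor 2.
- by constructor 3.
Qed.

Lemma gramE (R : realType) n d (p : 'I_n -> 'cV[R]_d) :
  gram p = (\matrix_(k < d, j < n) p j k 0)^T *m \matrix_(k < d, j < n) p j k 0.
Proof.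
apply/matrixP=> i j; rewrite !mxE /dotv mxE.
by apply: eq_bigr => k _; rewrite !mxE.
Qed.

Lemma psdmx_gram (R : realType) n d (p : 'I_n -> 'cV[R]_d) : psdmx (gram p).
Proof.
rewrite gramE; set Q := \matrix_(_, _) _; split.
  by apply/symmetricmxP; rewrite trmx_mul trmxK.
move=> x; rewrite mulmxA -mulmxA -trmx_mul mxE; apply: sumr_ge0 => k _.
by rewrite mxE -expr2 sqr_ge0.
Qed.

Lemma psd_completion_gram (R : realType) n d (G : tensegrity_graph n)
  (p : 'I_n -> 'cV[R]_d) : psd_completion G p (gram p).
Proof.
have psdP := psdmx_gram p; have [symP _] := psdP.
by split=> // i j _; rewrite mxE.
Qed.

Theorem theorem3p2 (R : realType) (n d : nat) (G : tensegrity_graph n)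
  (p : 'I_n -> 'cV[R]_d)
  (p_span : span [seq p i | i : 'I_n] = fullv)
  (Z_exists : exists Z : 'M[R]_n,
    Z \is symmetricmx /\
    (* (i) *)
    psdmx Z /\
    (* (ii) *)
    (forall i j, [set i; j] \in nonedges G -> Z i j = 0) /\
    (* (iii) *)
    ((forall i j, [set i; j] \in cables G -> 0 <= Z i j) /\
     (forall i j, [set i; j] \in struts G -> Z i j <= 0)) /\
    (* (iv) *)
    corank Z = d /\
    (* (v) *)
    (forall i, \sum_(j < n) Z i j *: p j = 0) /\
    (* (vi) *)
    (forall M : 'M[R]_d, M \is symmetricmx ->
       (forall i j,
          [set i; j] \in node_pairs n :|: bars G \/
          [set i; j] \in cables G :|: struts G /\ Z i j != 0 ->
          ((p i)^T *m M *m p j) 0 0 = 0) ->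
       M = 0)) :
  universally_completable G p.
Proof.
split=> [|X [sX psdX eqX leX geX]]; first exact: psd_completion_gram.
case: Z_exists => Z [sZ [psdZ [Znon [[Zcab Zstr] [crkZ [Zp condM]]]]]].
pose Q : 'M[R]_(d, n) := \matrix_(k, j) p j k 0.
have QZ : Q *m Z = 0.
  apply/matrixP=> k i; rewrite mxE [RHS]mxE.
  transitivity ((\sum_(j < n) Z i j *: p j) k 0); last by rewrite Zp mxE.
  rewrite summxE; apply: eq_bigr => j _.
  by rewrite !mxE mulrC -{1}(symmetricmxP _ sZ) mxE.
(* By (v) the rows of [Q] lie in the row kernel of [Z]. That kernel has dimension [n - \rank Z], the
   corank [d], which is also the rank of [Q], so the two spaces coincide. *)
have kerQ : (kermx Z <= Q)%MS.
  have QkerZ : (Q <= kermx Z)%MS by apply/sub_kermxP.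
  rewrite -(geq_leqif (mxrank_leqif_sup QkerZ)) mxrank_ker -mxrank_coker.
  by rewrite (eqP (row_free_span p_span)) [\rank _]crkZ.
have [symP _] := psdmx_gram p.
have trZP : \tr (Z *m gram p) = 0.
  by rewrite gramE mulmxA mxtrace_mulC mulmxA QZ mul0mx mxtrace0.
have term_ge0 i j : 0 <= Z i j * (gram p i j - X i j).
  rewrite mxE; case: (tensegrity_pair_cases G i j) => ij.
  - by rewrite eqX // subrr mulr0.
  - by rewrite mulr_ge0 ?subr_ge0 ?leX ?Zcab.
  - by rewrite mulr_le0 ?subr_le0 ?geX ?Zstr.
  - by rewrite Znon ?mul0r.
have trZX : - \tr (Z *m X) = \sum_i \sum_j Z i j * (gram p i j - X i j).
  rewrite -[LHS]add0r -[X in X - _]trZP !mxtrace_mul_sym // -sumrB; apply: eq_bigr => i _.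
  by rewrite -sumrB; apply: eq_bigr => j _; rewrite mulrBr.
have row_ge0 i : 0 <= \sum_j Z i j * (gram p i j - X i j) by apply: sumr_ge0.
have trZX_le0 : \tr (Z *m X) <= 0 by rewrite -oppr_ge0 trZX; apply: sumr_ge0.
have [W sW XE] := psdmx_factor_of_trace_le0 psdZ psdX trZX_le0 kerQ.
(* Cyclicity of the trace brings [Q] next to [Z]. *)
have trZX0 : \tr (Z *m X) = 0.
  by rewrite XE 2!mulmxA mxtrace_mulC !mulmxA QZ !mul0mx mxtrace0.
(* The nonnegative terms sum to zero, so first every row sum and then every term vanishes. *)
have term0 i j : Z i j * (gram p i j - X i j) = 0.
  move: trZX; rewrite trZX0 oppr0 => /esym.
  move/(psumr_eq0P (fun i _ => row_ge0 i))/(_ i isT).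
  by move/(psumr_eq0P (fun j _ => term_ge0 i j))/(_ j isT).
(* The Gram matrix is [Q^T *m 1%:M *m Q], so its difference from [X] is represented by
   [W - 1%:M]. *)
have XPE i j : X i j - gram p i j = ((p i)^T *m (W - 1%:M) *m p j) 0 0.
  have pE k : p k = Q *m delta_mx k 0.
    by rewrite -colE; apply/colP=> l; rewrite !mxE.
  rewrite !pE XE gramE -/Q.
  rewrite trmx_mul trmx_delta.
  have -> (M : 'M[R]_d) : 'e_i *m Q^T *m M *m (Q *m delta_mx j 0) =
     'e_i *m (Q^T *m M *m Q) *m delta_mx j 0 by rewrite !mulmxA.
  by rewrite -rowE -colE mulmxBr mulmx1 mulmxBl !mxE.
have W1 : W - 1%:M = 0.
  apply: condM => [|i j ij].
    by apply/symmetricmxP; rewrite linearB /= trmx1 (symmetricmxP _ sW).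
  (* On nodes and bars [X] agrees with the Gram matrix by feasibility; on a cable or strut with
     [Z i j != 0], the vanishing term can be divided by [Z i j]. *)
  rewrite -XPE; case: ij => [ij|[_ Zij]]; first by rewrite eqX // mxE subrr.
  by have /eqP := term0 i j; rewrite mulf_eq0 (negPf Zij) /= -oppr_eq0 opprB => /eqP.
apply/matrixP=> i j; apply/esym/eqP; rewrite -subr_eq0 XPE W1.
by rewrite mulmx0 mul0mx mxE.
Qed.
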